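(* Let $\omega$ be a circle with center $O$ and $\xi$ an ellipse with center $O$ lying inside $\omega$. Let $(u_1,\dots,u_n)$ be a Poncelet $n$-gon for the pair $(\omega,\xi)$. Then $\prod_{i=1}^n\cos\angle u_{i-1}u_iu_{i+1}$ is constant in the Poncelet family of $n$-gons containing $(u_1,\dots,u_n)$.
   Context: Indices are mod $n$. A Poncelet $n$-gon for a pair of conics $(C,D)$, $D$ inside $C$, is a closed polygon with all vertices on $C$ and all sides tangent to $D$. By the Poncelet porism, if one such closed $n$-gon exists, then starting from any point of $C$ and successively drawing tangent lines to $D$ (in the same rotational sense) produces a closed $n$-gon; the Poncelet family is this continuous 1-parameter family. $\angle u_{i-1}u_iu_{i+1}\in[0,\pi]$ is the angle at $u_i$ between the segments $u_iu_{i-1}$ and $u_iu_{i+1}$. *)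

(* Defs.v *)
From Stdlib Require Import Reals Lra.
Open Scope R_scope.

Definition pt := (R * R)%type.

Definition vsub (p q : pt) : pt := (fst p - fst q, snd p - snd q).
Definition dot (p q : pt) : R := fst p * fst q + snd p * snd q.
Definition det (p q : pt) : R := fst p * snd q - snd p * fst q.
Definition vnorm (p : pt) : R := sqrt (dot p p).
Definition pdist (p q : pt) : R := vnorm (vsub p q).

Definition angle (a b c : pt) : R :=
  acos (dot (vsub a b) (vsub c b) / (pdist a b * pdist c b)).

Definition on_circle (O : pt) (r : R) (p : pt) : Prop := pdist p O = r.

Definition on_ellipse (O : pt) (a b th : R) (p : pt) : Prop :=
  let d := vsub p O in
  (dot d (cos th, sin th)) ^ 2 / a ^ 2 + (dot d (- sin th, cos th)) ^ 2 / b ^ 2 = 1.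

Definition on_line (p q x : pt) : Prop := det (vsub q p) (vsub x p) = 0.

Definition tangent_to_ellipse (O : pt) (a b th : R) (p q : pt) : Prop :=
  exists! t : pt, on_ellipse O a b th t /\ on_line p q t.

Definition nxt (n i : nat) : nat := Nat.modulo (S i) n.
Definition prv (n i : nat) : nat := Nat.modulo (i + n - 1) n.

(* (u 0, ..., u (n-1)) is a Poncelet n-gon for (circle(O,r), ellipse(O,a,b,th)):
   vertices on the circle, consecutive vertices distinct, every side tangent to the
   ellipse, and at each vertex the two sides are the two distinct tangent lines
   (u_{i-1} <> u_{i+1}), i.e. the tangents are drawn in the same rotational sense. *)
Definition poncelet_ngon (n : nat) (O : pt) (r a b th : R) (u : nat -> pt) : Prop :=
  forall i, (i < n)%nat ->
    on_circle O r (u i) /\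
    u i <> u (nxt n i) /\
    tangent_to_ellipse O a b th (u i) (u (nxt n i)) /\
    u (prv n i) <> u (nxt n i).

Fixpoint prodR (f : nat -> R) (n : nat) : R :=
  match n with
  | O => 1
  | S k => prodR f k * f k
  end.

Definition cos_product (n : nat) (u : nat -> pt) : R :=
  prodR (fun i => cos (angle (u (prv n i)) (u i) (u (nxt n i)))) n.

(* Main.v *)
(** In coordinates along the axes of the ellipse, put R = r^2, A = a^2 - b^2 - R,
    B = b^2 - a^2 - R and C = (R - a^2 - b^2) R.  A chord of the circle from (x, y) to (x', y')
    is tangent to the ellipse iff A x x' + B y y' = C.  Hence the two neighbours of a vertex t
    lie on the line with normal N(t) = (A t1, B t2) at level C, which gives
    cos(angle at t) = C / sqrt(R |N(t)|^2), so it suffices that the product of |N(t)|^2 is the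
    same for both polygons.
    For a point z of the circle, |N(t)|^2 det(z, t+) det(t-, z) = R ((N(t).z)^2 - C^2), and the
    right-hand side is symmetric in t and z.  Taking (t, z) = (u_i, v_i) and (v_i, u_i), with
    X_i = det(u_i, v_{i+1}) and Y_i = det(v_i, u_{i+1}), gives
    |N(u_i)|^2 Y_i X_{i-1} = |N(v_i)|^2 X_i Y_{i-1}, whose product over i is the claim provided
    no X_i or Y_i vanishes.  If one does, some v_j equals +-u_i; the common orientation then
    makes v, up to signs, a cyclic shift of u. *)
Require Import Defs.
From Stdlib Require Import Reals Lra Lia Psatz Arith.
Open Scope R_scope.

(** * Coordinates along the axes of the ellipse *)

Definition frame (O : pt) (th : R) (p : pt) : pt :=
  (dot (vsub p O) (cos th, sin th), dot (vsub p O) (- sin th, cos th)).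

Definition opp (p : pt) : pt := (- fst p, - snd p).

(** The vector N(p) of the overview, normal to the line through the neighbours of a vertex [p]. *)
Definition diag (A B : R) (p : pt) : pt := (A * fst p, B * snd p).

Lemma sin2_cos2' (th : R) : sin th * sin th = 1 - cos th * cos th.
Proof. pose proof (sin2_cos2 th) as H; unfold Rsqr in H; lra. Qed.

Lemma frame_dot (O : pt) (th : R) (p q b : pt) :
  dot (vsub (frame O th p) (frame O th b)) (vsub (frame O th q) (frame O th b))
  = dot (vsub p b) (vsub q b).
Proof.
  unfold frame, dot, vsub; simpl.
  pose proof (sin2_cos2' th) as H.
  ring_simplify. replace (sin th ^ 2) with (1 - cos th ^ 2) by (simpl; lra). ring.
Qed.

Lemma frame_norm (O : pt) (th : R) (p : pt) :
  dot (frame O th p) (frame O th p) = dot (vsub p O) (vsub p O).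
Proof.
  rewrite <- (frame_dot O th p p O).
  unfold frame, dot, vsub; simpl; ring.
Qed.

Lemma frame_det (O : pt) (th : R) (p q : pt) :
  det (frame O th p) (frame O th q) = det (vsub p O) (vsub q O).
Proof.
  unfold frame, det, dot, vsub; simpl.
  pose proof (sin2_cos2' th) as H.
  ring_simplify. replace (sin th ^ 2) with (1 - cos th ^ 2) by (simpl; lra). ring.
Qed.

Lemma norm2_eq0 (p q : pt) : dot (vsub p q) (vsub p q) = 0 -> p = q.
Proof.
  destruct p as [p1 p2], q as [q1 q2]; unfold dot, vsub; simpl; intros H.
  destruct (Rplus_sqr_eq_0 (p1 - q1) (p2 - q2) H).
  f_equal; lra.
Qed.

Lemma frame_inj (O : pt) (th : R) (p q : pt) :
  frame O th p = frame O th q -> p = q.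
Proof.
  intros H; apply norm2_eq0.
  rewrite <- (frame_dot O th p p q), H.
  unfold dot, vsub; simpl; ring.
Qed.

Lemma vnorm_sq (p : pt) : vnorm p * vnorm p = dot p p.
Proof. apply sqrt_sqrt; unfold dot; nra. Qed.

Lemma on_circle_frame (O : pt) (r th : R) (p : pt) :
  on_circle O r p -> dot (frame O th p) (frame O th p) = r ^ 2.
Proof.
  unfold on_circle, pdist; intros H.
  rewrite frame_norm, <- vnorm_sq, H; ring.
Qed.

(** * Semi-axes of the inner ellipse and tangent chords *)

(** The end points of the semi-axes lie on the ellipse at distances [a] and [b] from [O]. *)
Lemma inside_semiaxes (O : pt) (r a b th : R) :
  0 < r -> 0 < a -> 0 < b ->
  (forall p, on_ellipse O a b th p -> pdist p O < r) -> a < r /\ b < r.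
Proof.
  intros Hr Ha Hb H.
  pose proof (sin2_cos2' th) as Hs.
  assert (Hlt : forall p d, 0 < d ->
            dot (vsub p O) (vsub p O) = d * d -> pdist p O < r -> d < r).
  { intros p d Hd Hp Hl. unfold pdist, vnorm in Hl.
    rewrite Hp, sqrt_square in Hl; lra. }
  split.
  - apply (Hlt (fst O + a * cos th, snd O + a * sin th) a Ha).
    + unfold dot, vsub; simpl.
      replace (_ + _) with (a * a * (cos th * cos th + sin th * sin th)) by ring.
      rewrite Hs; ring.
    + apply H; unfold on_ellipse, dot, vsub; simpl fst; simpl snd.
      transitivity ((a * (sin th * sin th + cos th * cos th)) ^ 2 / a ^ 2);
        [field; lra | rewrite Hs; field; lra].
  - apply (Hlt (fst O - b * sin th, snd O + b * cos th) b Hb).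
    + unfold dot, vsub; simpl.
      replace (_ + _) with (b * b * (cos th * cos th + sin th * sin th)) by ring.
      rewrite Hs; ring.
    + apply H; unfold on_ellipse, dot, vsub; simpl fst; simpl snd.
      transitivity ((b * (sin th * sin th + cos th * cos th)) ^ 2 / b ^ 2);
        [field; lra | rewrite Hs; field; lra].
Qed.

(* A line parametrised by [s] meets the ellipse where a quadratic in [s] vanishes;
   tangency means that its discriminant does. *)
Lemma tangent_discriminant (O : pt) (a b th : R) (p q : pt) :
  0 < a -> 0 < b -> p <> q -> tangent_to_ellipse O a b th p q ->
  det (frame O th p) (frame O th q) ^ 2 =
  a ^ 2 * (snd (frame O th q) - snd (frame O th p)) ^ 2
  + b ^ 2 * (fst (frame O th q) - fst (frame O th p)) ^ 2.
Proof.
  intros Ha Hb Hpq [t [[Hte Htl] Hu]].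
  set (x := fst (frame O th p)); set (y := snd (frame O th p)).
  set (dx := fst (frame O th q) - x); set (dy := snd (frame O th q) - y).
  set (pnt := fun s => (fst p + s * (fst q - fst p), snd p + s * (snd q - snd p))).
  assert (Hline : forall s, on_line p q (pnt s)).
  { intros s; unfold on_line, det, vsub, pnt; simpl; ring. }
  assert (Hell : forall s, on_ellipse O a b th (pnt s) <->
                    (x + s * dx) ^ 2 / a ^ 2 + (y + s * dy) ^ 2 / b ^ 2 = 1).
  { intros s; unfold on_ellipse.
    replace (dot (vsub (pnt s) O) (cos th, sin th)) with (x + s * dx)
      by (unfold x, dx, x, frame, pnt, dot, vsub; simpl; ring).
    replace (dot (vsub (pnt s) O) (- sin th, cos th)) with (y + s * dy)
      by (unfold y, dy, y, frame, pnt, dot, vsub; simpl; ring).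
    tauto. }
  assert (Hd2 : dot (vsub q p) (vsub q p) <> 0).
  { intros E; apply norm2_eq0 in E; congruence. }
  assert (Hdd : dx * dx + dy * dy <> 0).
  { intros E; apply Hd2. rewrite <- (frame_dot O th q q p).
    unfold dot, vsub; cbn [fst snd]. fold x y dx dy. exact E. }
  (* Parameter of the orthogonal projection of [t] on the line; [t] is its own projection because
     the determinant in [Htl] vanishes. *)
  set (s := dot (vsub t p) (vsub q p) / dot (vsub q p) (vsub q p)).
  assert (Hts : t = pnt s).
  { assert (E1 : fst t - fst p = s * (fst q - fst p)).
    { apply Rmult_eq_reg_r with (dot (vsub q p) (vsub q p)); [| exact Hd2].
      transitivity (dot (vsub t p) (vsub q p) * (fst q - fst p)
                    - (snd q - snd p) * det (vsub q p) (vsub t p));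
        [unfold dot, det, vsub; simpl; ring | rewrite Htl; unfold s; field; exact Hd2]. }
    assert (E2 : snd t - snd p = s * (snd q - snd p)).
    { apply Rmult_eq_reg_r with (dot (vsub q p) (vsub q p)); [| exact Hd2].
      transitivity (dot (vsub t p) (vsub q p) * (snd q - snd p)
                    + (fst q - fst p) * det (vsub q p) (vsub t p));
        [unfold dot, det, vsub; simpl; ring | rewrite Htl; unfold s; field; exact Hd2]. }
    unfold pnt; rewrite <- E1, <- E2. rewrite (surjective_pairing t) at 1.
    f_equal; ring. }
  assert (Hs : b ^ 2 * (x + s * dx) ^ 2 + a ^ 2 * (y + s * dy) ^ 2 = a ^ 2 * b ^ 2).
  { rewrite Hts in Hte. apply Hell in Hte.
    transitivity (a ^ 2 * b ^ 2 * ((x + s * dx) ^ 2 / a ^ 2 + (y + s * dy) ^ 2 / b ^ 2)).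
    - field; lra.
    - rewrite Hte; ring. }
  (* Leading coefficient and half the linear coefficient of the quadratic in [s], cleared of
     denominators. *)
  set (al := b ^ 2 * dx ^ 2 + a ^ 2 * dy ^ 2).
  set (be := b ^ 2 * x * dx + a ^ 2 * y * dy).
  assert (Hal : al <> 0).
  { unfold al; intros E.
    assert (0 < a ^ 2 /\ 0 < b ^ 2) as [Ha2 Hb2] by (split; nra).
    assert (dx * dx = 0 /\ dy * dy = 0) as [E1 E2] by (split; nra).
    lra. }
  (* The other root, by Vieta. It also gives a common point of line and ellipse, so uniqueness of
     [t] forces a double root. *)
  set (s' := - 2 * be / al - s).
  assert (Hs' : t = pnt s').
  { apply Hu; split; [| apply Hline]. apply Hell.
    apply Rmult_eq_reg_l with (a ^ 2 * b ^ 2); [| apply Rmult_integral_contrapositive; split; nra].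
    transitivity (b ^ 2 * (x + s' * dx) ^ 2 + a ^ 2 * (y + s' * dy) ^ 2); [field; lra |].
    transitivity (al * s' ^ 2 + 2 * be * s' + (b ^ 2 * x ^ 2 + a ^ 2 * y ^ 2));
      [unfold al, be; ring |].
    transitivity (al * s ^ 2 + 2 * be * s + (b ^ 2 * x ^ 2 + a ^ 2 * y ^ 2));
      [unfold s'; field; exact Hal |].
    transitivity (b ^ 2 * (x + s * dx) ^ 2 + a ^ 2 * (y + s * dy) ^ 2);
      [unfold al, be; ring | lra]. }
  assert (Hss : s = s').
  { rewrite Hts in Hs'. unfold pnt in Hs'. injection Hs' as E1 E2.
    destruct (Req_dec s s') as [E | E]; [exact E | exfalso; apply Hd2].
    assert (fst q - fst p = 0) as F1 by (apply (Rmult_eq_reg_l (s - s')); lra).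
    assert (snd q - snd p = 0) as F2 by (apply (Rmult_eq_reg_l (s - s')); lra).
    unfold dot, vsub; simpl; rewrite F1, F2; ring. }
  assert (Hbe : be = - (al * s)).
  { assert (E : al * s = al * (- 2 * be / al - s)) by (f_equal; exact Hss).
    replace (al * (- 2 * be / al - s)) with (- 2 * be - al * s) in E by (field; exact Hal).
    lra. }
  assert (Hq : al * s ^ 2 + 2 * be * s + (b ^ 2 * x ^ 2 + a ^ 2 * y ^ 2 - a ^ 2 * b ^ 2) = 0).
  { rewrite <- (Rminus_diag (a ^ 2 * b ^ 2)), <- Hs at 1. unfold al, be; ring. }
  assert (Hdisc : be ^ 2 = al * (b ^ 2 * x ^ 2 + a ^ 2 * y ^ 2 - a ^ 2 * b ^ 2)).
  { replace (b ^ 2 * x ^ 2 + a ^ 2 * y ^ 2 - a ^ 2 * b ^ 2) with (- (al * s ^ 2 + 2 * be * s)) by lra.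
    rewrite Hbe; ring. }
  fold x y dx dy.
  replace (det (frame O th p) (frame O th q)) with (x * dy - y * dx)
    by (unfold det, dx, dy; fold x y; ring).
  (* Combines [Hdisc] with the identity [al (b^2 x^2 + a^2 y^2) - be^2 = a^2 b^2 (x dy - y
     dx)^2]. *)
  apply Rmult_eq_reg_l with (a ^ 2 * b ^ 2); [| apply Rmult_integral_contrapositive; split; nra].
  unfold al, be in Hdisc. lra.
Qed.

(* The factor [|q - p|^2], nonzero for a genuine chord, splits off from the discriminant:
   what remains is bilinear in the endpoints. *)
Lemma tangent_chord_bilinear (R a b : R) (p q : pt) :
  dot p p = R -> dot q q = R -> p <> q ->
  det p q ^ 2 = a ^ 2 * (snd q - snd p) ^ 2 + b ^ 2 * (fst q - fst p) ^ 2 ->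
  dot (diag (a ^ 2 - b ^ 2 - R) (b ^ 2 - a ^ 2 - R) p) q = (R - a ^ 2 - b ^ 2) * R.
Proof.
  intros Hp Hq Hpq Ht.
  assert (Hc : R - dot p q <> 0).
  { intros E; apply Hpq, norm2_eq0. rewrite <- Hp in Hq.
    replace (dot (vsub p q) (vsub p q)) with (dot p p + dot q q - 2 * dot p q)
      by (unfold dot, vsub; simpl; ring). lra. }
  destruct p as [x y], q as [x' y']; unfold dot, det, diag in *; simpl fst in *; simpl snd in *.
  apply Rmult_eq_reg_l with (R - (x * x' + y * y')); [| exact Hc].
  assert (Ex : x ^ 2 = R - y ^ 2) by lra. assert (Ex' : x' ^ 2 = R - y' ^ 2) by lra.
  (* On the circle all three squares, the first two after multiplication by [R], contain the factor
     [R - dot p q], half the squared chord length. *)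
  assert (E1 : R * (y' - y) ^ 2 = (R - (x * x' + y * y')) * (R + (x * x' - y * y'))).
  { transitivity (R ^ 2 - 2 * R * (y * y') - x ^ 2 * x' ^ 2 + y ^ 2 * y' ^ 2); [| ring].
    rewrite Ex, Ex'; ring. }
  assert (E2 : R * (x' - x) ^ 2 = (R - (x * x' + y * y')) * (R - (x * x' - y * y'))).
  { transitivity (R ^ 2 - 2 * R * (x * x') + x ^ 2 * x' ^ 2 - y ^ 2 * y' ^ 2); [| ring].
    transitivity (R * (x ^ 2 + x' ^ 2 - 2 * (x * x'))); [ring |].
    rewrite Ex, Ex'; ring. }
  assert (E3 : (x * y' - y * x') ^ 2 = (R - (x * x' + y * y')) * (R + (x * x' + y * y'))).
  { transitivity ((x*x+y*y)*(x'*x'+y'*y') - (x * x' + y * y')^2); [ring|]. rewrite Hp, Hq. ring. }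
  assert (E4 : R * (x * y' - y * x') ^ 2 =
     a ^ 2 * (R * (y' - y) ^ 2) + b ^ 2 * (R * (x' - x) ^ 2)) by (rewrite Ht; ring).
  rewrite E1, E2, E3 in E4. lra.
Qed.

(** * Chords of the circle with a given normal *)

Definition perp (p : pt) : pt := (- snd p, fst p).

(** Both ends have component [C] along [N], so their components along [perp N] have equal squares;
    as the ends differ, these components are opposite, and [k] is that of [q]. *)
Lemma chord_ends (N p q : pt) (C R : R) :
  dot N N <> 0 -> dot p p = R -> dot q q = R -> dot N p = C -> dot N q = C -> p <> q ->
  exists k, k ^ 2 = R * dot N N - C ^ 2 /\
    forall z, dot N N * dot z p = C * dot N z - k * dot (perp N) z /\
              dot N N * dot z q = C * dot N z + k * dot (perp N) z.
Proof.
  intros HM Hp Hq Np Nq Hpq.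
  assert (dec : forall z w, dot N N * dot z w = dot N w * dot N z + dot (perp N) w * dot (perp N) z).
  { intros; unfold dot, perp; simpl; ring. }
  assert (Kp := dec p p); rewrite Hp, Np in Kp.
  assert (Kq := dec q q); rewrite Hq, Nq in Kq.
  exists (dot (perp N) q).
  assert (Ep : dot (perp N) p = - dot (perp N) q).
  { assert (E : (dot (perp N) p + dot (perp N) q) * (dot (perp N) p - dot (perp N) q) = 0) by lra.
    apply Rmult_integral in E as [E | E]; [lra | exfalso; apply Hpq].
    apply norm2_eq0. apply Rmult_eq_reg_l with (dot N N); [| exact HM].
    rewrite dec.
    replace (dot N (vsub p q)) with (dot N p - dot N q) by (unfold dot, vsub; simpl; ring).
    replace (dot (perp N) (vsub p q)) with (dot (perp N) p - dot (perp N) q)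
      by (unfold dot, vsub; simpl; ring).
    rewrite E, Np, Nq; ring. }
  split; [lra | intros z].
  rewrite !dec, Np, Nq, Ep; split; ring.
Qed.

(** Each determinant is, up to sign, a dot product with [perp z], so [chord_ends] at [perp z] turns
    the product into a difference of squares. *)
Lemma chord_det_product (N p q z : pt) (C R : R) :
  dot N N <> 0 -> dot p p = R -> dot q q = R -> dot z z = R ->
  dot N p = C -> dot N q = C -> p <> q ->
  dot N N * (det z q * det p z) = R * (dot N z ^ 2 - C ^ 2).
Proof.
  intros HM Hp Hq Hz Np Nq Hpq.
  destruct (chord_ends N p q C R HM Hp Hq Np Nq Hpq) as [k [Hk H]].
  destruct (H (perp z)) as [H1 H2].
  replace (det z q) with (dot (perp z) q) by (unfold det, dot, perp; simpl; ring).
  replace (det p z) with (- dot (perp z) p) by (unfold det, dot, perp; simpl; ring).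
  apply Rmult_eq_reg_l with (dot N N); [| exact HM].
  transitivity (- ((dot N N * dot (perp z) p) * (dot N N * dot (perp z) q))); [ring |].
  rewrite H1, H2.
  replace (dot (perp N) (perp z)) with (dot N z) by (unfold dot, perp; simpl; ring).
  transitivity (k ^ 2 * dot N z ^ 2 - C ^ 2 * dot N (perp z) ^ 2); [ring |].
  rewrite Hk.
  replace (dot N (perp z) ^ 2) with (R * dot N N - dot N z ^ 2)
    by (rewrite <- Hz; unfold dot, perp; simpl; ring).
  ring.
Qed.

(** The inscribed angle theorem: [t] enters only through [e = C - dot N t], which cancels between
    the dot product and the two lengths. The condition [dot N t < C] fixes the sign. *)
Lemma cos_angle_chord (N p q t : pt) (C R : R) :
  0 < R -> 0 < dot N N -> dot p p = R -> dot q q = R -> dot t t = R ->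
  dot N p = C -> dot N q = C -> p <> q -> dot N t < C ->
  cos (angle p t q) = C / sqrt (R * dot N N).
Proof.
  intros HR HM Hp Hq Ht Np Nq Hpq Hlt.
  destruct (chord_ends N p q C R (Rgt_not_eq _ _ HM) Hp Hq Np Nq Hpq) as [k [Hk H]].
  set (M := dot N N) in *. set (e := C - dot N t).
  destruct (H t) as [Htp Htq].
  destruct (H p) as [_ Hpq']. rewrite Np in Hpq'.
  assert (Hkp : k * dot (perp N) p = - k ^ 2).
  { destruct (H p) as [Hpp _]. rewrite Hp, Np in Hpp. rewrite Hk. lra. }
  assert (HRM : 0 < R * M) by nra.
  assert (HS : dot (vsub p t) (vsub q t) = 2 * C * e / M).
  { apply Rmult_eq_reg_l with M; [| lra].
    transitivity (M * dot p q - M * dot t p - M * dot t q + M * dot t t);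
      [unfold dot, vsub; simpl; ring |].
    rewrite Hpq', Htp, Htq, Hkp, Hk, Ht; unfold e; field; lra. }
  assert (HP : dot (vsub p t) (vsub p t) * dot (vsub q t) (vsub q t) = 4 * R * e ^ 2 / M).
  { apply Rmult_eq_reg_l with (M ^ 2); [| nra].
    replace (dot (vsub p t) (vsub p t)) with (dot p p + dot t t - 2 * dot t p)
      by (unfold dot, vsub; simpl; ring).
    replace (dot (vsub q t) (vsub q t)) with (dot q q + dot t t - 2 * dot t q)
      by (unfold dot, vsub; simpl; ring).
    rewrite Hp, Hq, Ht.
    transitivity (4 * (R * M - M * dot t p) * (R * M - M * dot t q)); [ring |].
    rewrite Htp, Htq.
    transitivity (4 * ((R * M - C * dot N t) ^ 2 - k ^ 2 * dot (perp N) t ^ 2)); [ring |].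
    replace (dot (perp N) t ^ 2) with (R * M - dot N t ^ 2)
      by (rewrite <- Ht; unfold M, dot, perp; simpl; ring).
    rewrite Hk; unfold e; field; lra. }
  assert (Hsq : sqrt (R * M) * sqrt (R * M) = R * M) by (apply sqrt_sqrt; lra).
  assert (Hs0 : 0 < sqrt (R * M)) by (apply sqrt_lt_R0; lra).
  unfold angle, pdist, vnorm.
  rewrite <- sqrt_mult_alt by (unfold dot; nra).
  rewrite HP, HS.
  replace (4 * R * e ^ 2 / M) with ((2 * e * sqrt (R * M) / M) * (2 * e * sqrt (R * M) / M)).
  2: { transitivity (4 * e ^ 2 * (sqrt (R * M) * sqrt (R * M)) / M ^ 2); [field; lra |].
       rewrite Hsq; field; lra. }
  assert (He : 0 < e) by (unfold e; lra).
  rewrite sqrt_square.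
  2: { apply Rmult_le_pos; [nra | left; apply Rinv_0_lt_compat; lra]. }
  replace (2 * C * e / M / (2 * e * sqrt (R * M) / M)) with (C / sqrt (R * M)) by (field; lra).
  apply cos_acos.
  (* The quotient lies in [-1, 1], the range where [cos_acos] applies, because [k ^ 2 = R M - C ^ 2]
     is nonnegative. *)
  assert (HC : Rabs C <= sqrt (R * M)).
  { apply Rsqr_incr_0_var; [| lra]. rewrite <- Rsqr_abs. unfold Rsqr. nra. }
  assert (HC1 := Rle_abs C). assert (HC2 := Rle_abs (- C)). rewrite Rabs_Ropp in HC2.
  split; apply Rmult_le_reg_r with (sqrt (R * M)); try lra;
    unfold Rdiv; rewrite Rmult_assoc, Rinv_l; lra.
Qed.

Lemma frame_angle (O : pt) (th : R) (p t q : pt) :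
  angle (frame O th p) (frame O th t) (frame O th q) = angle p t q.
Proof. unfold angle, pdist, vnorm; rewrite !frame_dot; reflexivity. Qed.

(** * Cyclic indices and products *)

Lemma prv_lt (n i : nat) : (0 < n)%nat -> (prv n i < n)%nat.
Proof. intros; apply Nat.mod_upper_bound; lia. Qed.

Lemma nxt_lt (n i : nat) : (0 < n)%nat -> (nxt n i < n)%nat.
Proof. intros; apply Nat.mod_upper_bound; lia. Qed.

Lemma nxt_prv (n i : nat) : (i < n)%nat -> nxt n (prv n i) = i.
Proof.
  intros H; unfold nxt, prv.
  rewrite <- Nat.add_1_r, Nat.Div0.add_mod_idemp_l.
  replace (i + n - 1 + 1)%nat with (i + 1 * n)%nat by lia.
  rewrite Nat.Div0.mod_add; apply Nat.mod_small, H.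
Qed.

Lemma prv_nxt (n i : nat) : (i < n)%nat -> prv n (nxt n i) = i.
Proof.
  intros H; unfold nxt, prv.
  replace ((S i mod n) + n - 1)%nat with ((S i mod n) + (n - 1))%nat by lia.
  rewrite Nat.Div0.add_mod_idemp_l.
  replace (S i + (n - 1))%nat with (i + 1 * n)%nat by lia.
  rewrite Nat.Div0.mod_add; apply Nat.mod_small, H.
Qed.

Lemma prodR_ext (f g : nat -> R) (n : nat) :
  (forall i, (i < n)%nat -> f i = g i) -> prodR f n = prodR g n.
Proof.
  induction n as [| n IH]; intros H; simpl; [reflexivity |].
  rewrite IH, H; auto with arith.
Qed.

Lemma prodR_mult (f g : nat -> R) (n : nat) :
  prodR (fun i => f i * g i) n = prodR f n * prodR g n.
Proof. induction n as [| n IH]; simpl; [| rewrite IH]; ring. Qed.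

Lemma prodR_eq0 (f : nat -> R) (n : nat) :
  prodR f n = 0 -> exists i, (i < n)%nat /\ f i = 0.
Proof.
  induction n as [| n IH]; simpl; intros H; [lra |].
  apply Rmult_integral in H as [H | H].
  - destruct (IH H) as [i [Hi E]]; exists i; split; [lia | exact E].
  - exists n; split; [lia | exact H].
Qed.

(** Positivity of the product is part of the conclusion because the induction needs it to split the
    square root. *)
Lemma prodR_div_sqrt (f : nat -> R) (c : R) (n : nat) :
  (forall i, (i < n)%nat -> 0 < f i) ->
  prodR (fun i => c / sqrt (f i)) n = c ^ n / sqrt (prodR f n) /\ 0 < prodR f n.
Proof.
  induction n as [| n IH]; intros H; simpl.
  - rewrite sqrt_1; split; [field | lra].
  - destruct IH as [-> Hn]; [auto with arith |].
    assert (Hf := H n (Nat.lt_succ_diag_r n)).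
    split; [| apply Rmult_lt_0_compat; assumption].
    rewrite sqrt_mult_alt by lra.
    field; split; apply Rgt_not_eq, sqrt_lt_R0; assumption.
Qed.

Lemma prodR_nxt (f : nat -> R) (n : nat) :
  prodR (fun i => f (nxt n i)) n = prodR f n.
Proof.
  destruct n as [| n]; [reflexivity |].
  assert (Hshift : prodR (fun i => f (S i)) n * f 0%nat = prodR f n * f n).
  { clear; induction n as [| n IH]; simpl; [ring |].
    replace (prodR (fun i => f (S i)) n * f (S n) * f 0%nat)
      with (prodR (fun i => f (S i)) n * f 0%nat * f (S n)) by ring.
    rewrite IH; ring. }
  cbn [prodR]. rewrite <- Hshift. f_equal.
  - apply prodR_ext; intros i Hi; unfold nxt; f_equal. apply Nat.mod_small; lia.
  (* The last index wraps round to 0. *)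
  - unfold nxt; f_equal. apply Nat.Div0.mod_same.
Qed.

Lemma prodR_prv (f : nat -> R) (n : nat) :
  prodR (fun i => f (prv n i)) n = prodR f n.
Proof.
  rewrite <- (prodR_nxt (fun i => f (prv n i))).
  apply prodR_ext; intros i Hi; rewrite prv_nxt; auto.
Qed.

Lemma prodR_shift (f : nat -> R) (n j : nat) :
  prodR (fun k => f ((k + j) mod n)) n = prodR f n.
Proof.
  induction j as [| j IH].
  - apply prodR_ext; intros i Hi; rewrite Nat.add_0_r, Nat.mod_small; auto.
  - rewrite <- IH, <- (prodR_nxt (fun k => f ((k + j) mod n))).
    apply prodR_ext; intros i Hi; unfold nxt; f_equal.
    rewrite Nat.Div0.add_mod_idemp_l; f_equal; lia.
Qed.

(** * Conjugate polygons and their orientation *)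

(* Consecutive vertices are conjugate: each lies on the level-[C] polar of the other with
   respect to the quadratic form [diag A B]. *)
Definition conjugate_polygon (n : nat) (A B C R : R) (w : nat -> pt) : Prop :=
  forall i, (i < n)%nat ->
    dot (w i) (w i) = R /\ dot (diag A B (w i)) (w (nxt n i)) = C /\ w (prv n i) <> w (nxt n i).

Definition weight (A B : R) (p : pt) : R := dot (diag A B p) (diag A B p).

Lemma diag_sym (A B : R) (p q : pt) : dot (diag A B p) q = dot (diag A B q) p.
Proof. unfold dot, diag; simpl; ring. Qed.

Lemma conjugate_prv (n : nat) (A B C R : R) (w : nat -> pt) (i : nat) :
  conjugate_polygon n A B C R w -> (i < n)%nat -> dot (diag A B (w i)) (w (prv n i)) = C.
Proof.
  intros H Hi. rewrite diag_sym.
  destruct (H (prv n i)) as [_ [E _]]; [apply prv_lt; lia |].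
  rewrite nxt_prv in E; auto.
Qed.

(** The chord joining the two neighbours of [w i] has normal [diag A B (w i)] and level [C]. *)
Lemma conjugate_det_product (n : nat) (A B C R : R) (w : nat -> pt) (i : nat) (z : pt) :
  conjugate_polygon n A B C R w -> (i < n)%nat -> 0 < weight A B (w i) -> dot z z = R ->
  weight A B (w i) * (det z (w (nxt n i)) * det (w (prv n i)) z)
  = R * (dot (diag A B (w i)) z ^ 2 - C ^ 2).
Proof.
  intros H Hi HM Hz. destruct (H i Hi) as [H1 [H2 H3]].
  apply chord_det_product; auto.
  - apply Rgt_not_eq, HM.
  - apply H, prv_lt; lia.
  - apply H, nxt_lt; lia.
  - eapply conjugate_prv; eauto.
Qed.

(** Taking [z = w i] in the determinant formula makes its right-hand side positive: the polygon
    never reverses its sense of rotation about the centre. *)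
Lemma conjugate_orientation (n : nat) (A B C R : R) (w : nat -> pt) (i : nat) :
  0 < R -> (forall p, dot p p = R -> 0 < weight A B p /\ C ^ 2 < dot (diag A B p) p ^ 2) ->
  conjugate_polygon n A B C R w -> (i < n)%nat ->
  0 < det (w (prv n i)) (w i) * det (w i) (w (nxt n i)).
Proof.
  intros HR HP H Hi. destruct (H i Hi) as [H1 _]. destruct (HP _ H1) as [HM HC].
  pose proof (conjugate_det_product n A B C R w i (w i) H Hi HM H1) as E.
  nra.
Qed.

Lemma conjugate_orientation0 (n : nat) (A B C R : R) (w : nat -> pt) (i : nat) :
  0 < R -> (forall p, dot p p = R -> 0 < weight A B p /\ C ^ 2 < dot (diag A B p) p ^ 2) ->
  conjugate_polygon n A B C R w -> (i < n)%nat ->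
  0 < det (w 0%nat) (w (nxt n 0)) * det (w i) (w (nxt n i)).
Proof.
  intros HR HP H. induction i as [| i IH]; intros Hi.
  - pose proof (conjugate_orientation n A B C R w 0 HR HP H Hi). nra.
  - pose proof (conjugate_orientation n A B C R w (S i) HR HP H Hi) as E.
    assert (En : nxt n i = S i) by (unfold nxt; apply Nat.mod_small; auto).
    assert (Ep : prv n (S i) = i).
    { rewrite <- En; apply prv_nxt; lia. }
    rewrite Ep in E. specialize (IH ltac:(lia)). rewrite En in IH.
    nra.
Qed.

(** * Polygons sharing a vertex up to sign *)

Definition same_line (p q : pt) : Prop := p = q \/ p = opp q.

Lemma det_eq0_same_line (p q : pt) (R : R) :
  0 < R -> dot p p = R -> dot q q = R -> det p q = 0 -> same_line p q.
Proof.
  intros HR Hp Hq Hd.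
  assert (Hpq : dot p q ^ 2 = R ^ 2).
  { transitivity (dot p p * dot q q - det p q ^ 2);
      [unfold dot, det; simpl; ring | rewrite Hp, Hq, Hd; ring]. }
  assert (E : (dot p q - R) * (dot p q + R) = 0) by lra.
  apply Rmult_integral in E as [E | E]; [left | right]; apply norm2_eq0.
  - transitivity (dot p p + dot q q - 2 * dot p q);
      [unfold dot, vsub; simpl; ring | lra].
  - transitivity (dot p p + dot q q + 2 * dot p q);
      [unfold dot, opp, vsub; simpl; ring | lra].
Qed.

Lemma weight_same_line (A B : R) (p q : pt) : same_line p q -> weight A B p = weight A B q.
Proof. intros [-> | ->]; unfold weight, dot, diag, opp; simpl; ring. Qed.

(** If [z] differed from the next vertex, the two would be the ends of the polar chord of [u i], and
    the determinant formula would put them on opposite sides of the line through the centre and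
    [u i]. *)
Lemma conjugate_next_unique (n : nat) (A B C R : R) (u : nat -> pt) (i : nat) (z : pt) :
  0 < R -> (forall p, dot p p = R -> 0 < weight A B p /\ C ^ 2 < dot (diag A B p) p ^ 2) ->
  conjugate_polygon n A B C R u -> (i < n)%nat ->
  dot z z = R -> dot (diag A B (u i)) z = C -> 0 < det (u i) (u (nxt n i)) * det (u i) z ->
  z = u (nxt n i).
Proof.
  intros HR HP H Hi Hz Hzc Hs.
  destruct (H i Hi) as [H1 [H2 H3]]. destruct (HP _ H1) as [HM HC].
  destruct (H (nxt n i) (nxt_lt n i ltac:(lia))) as [Hn _].
  assert (Hdec : {z = u (nxt n i)} + {z <> u (nxt n i)}).
  { destruct z as [z1 z2], (u (nxt n i)) as [q1 q2].
    destruct (Req_EM_T z1 q1) as [-> | E1]; [destruct (Req_EM_T z2 q2) as [-> | E2] |];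
      [left; reflexivity | right; congruence | right; congruence]. }
  destruct Hdec as [E | E]; [exact E | exfalso].
  pose proof (chord_det_product (diag A B (u i)) z (u (nxt n i)) (u i) C R
                (Rgt_not_eq _ _ HM) Hz Hn H1 Hzc H2 E) as F.
  change (dot (diag A B (u i)) (diag A B (u i))) with (weight A B (u i)) in F.
  replace (det z (u i)) with (- det (u i) z) in F by (unfold det; ring).
  nra.
Qed.

(** In the antipodal case, negating both [v j] and its successor preserves conjugacy and
    orientation, so the uniqueness of the next vertex applies again. *)
Lemma same_line_next (n : nat) (A B C R : R) (u v : nat -> pt) (i j : nat) :
  0 < R -> (forall p, dot p p = R -> 0 < weight A B p /\ C ^ 2 < dot (diag A B p) p ^ 2) ->
  conjugate_polygon n A B C R u -> conjugate_polygon n A B C R v ->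
  0 < det (u 0%nat) (u (nxt n 0)) * det (v 0%nat) (v (nxt n 0)) ->
  (i < n)%nat -> (j < n)%nat -> same_line (v j) (u i) ->
  same_line (v (nxt n j)) (u (nxt n i)).
Proof.
  intros HR HP Hu Hv Ho Hi Hj Hs.
  pose proof (conjugate_orientation0 n A B C R u i HR HP Hu Hi) as Ou.
  pose proof (conjugate_orientation0 n A B C R v j HR HP Hv Hj) as Ov.
  assert (Hpos : 0 < det (u i) (u (nxt n i)) * det (v j) (v (nxt n j))).
  { apply Rmult_lt_reg_l with
      (det (u 0%nat) (u (nxt n 0)) * det (v 0%nat) (v (nxt n 0))); [exact Ho |].
    rewrite Rmult_0_r.
    replace (_ * _) with ((det (u 0%nat) (u (nxt n 0)) * det (u i) (u (nxt n i)))
      * (det (v 0%nat) (v (nxt n 0)) * det (v j) (v (nxt n j)))) by ring.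
    apply Rmult_lt_0_compat; assumption. }
  destruct (Hv j Hj) as [_ [Hvc _]].
  destruct (Hv (nxt n j) (nxt_lt n j ltac:(lia))) as [Hvn _].
  destruct Hs as [E | E]; rewrite E in Hpos, Hvc; [left | right].
  - apply (conjugate_next_unique n A B C R u i); auto.
  - rewrite <- (conjugate_next_unique n A B C R u i (opp (v (nxt n j))) HR HP Hu Hi).
    + unfold opp; destruct (v (nxt n j)); simpl; f_equal; ring.
    + rewrite <- Hvn; unfold dot, opp; simpl; ring.
    + rewrite <- Hvc; unfold dot, diag, opp; simpl; ring.
    + replace (det (u i) (opp (v (nxt n j)))) with (det (opp (u i)) (v (nxt n j)))
        by (unfold det, opp; simpl; ring).
      exact Hpos.
Qed.

(** One coincidence propagates along both polygons, so the weights agree after cyclic shifts by [i]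
    and [j]. *)
Lemma weight_product_of_same_line (n : nat) (A B C R : R) (u v : nat -> pt) (i j : nat) :
  0 < R -> (forall p, dot p p = R -> 0 < weight A B p /\ C ^ 2 < dot (diag A B p) p ^ 2) ->
  conjugate_polygon n A B C R u -> conjugate_polygon n A B C R v ->
  0 < det (u 0%nat) (u (nxt n 0)) * det (v 0%nat) (v (nxt n 0)) ->
  (i < n)%nat -> (j < n)%nat -> same_line (v j) (u i) ->
  prodR (fun k => weight A B (u k)) n = prodR (fun k => weight A B (v k)) n.
Proof.
  intros HR HP Hu Hv Ho Hi Hj Hs.
  rewrite <- (prodR_shift (fun k => weight A B (u k)) n i).
  rewrite <- (prodR_shift (fun k => weight A B (v k)) n j).
  apply prodR_ext; intros k _. symmetry; apply weight_same_line.
  induction k as [| k IH].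
  - simpl; rewrite !Nat.mod_small; auto.
  - assert (Hst : forall m, ((S k + m) mod n)%nat = nxt n ((k + m) mod n)).
    { intros m; unfold nxt. rewrite <- (Nat.add_1_r ((k + m) mod n)).
      rewrite Nat.Div0.add_mod_idemp_l; f_equal; lia. }
    rewrite !Hst.
    apply (same_line_next n A B C R); auto; apply Nat.mod_upper_bound; lia.
Qed.

(** * Equality of the weight products *)

Lemma weight_product (n : nat) (A B C R : R) (u v : nat -> pt) :
  (0 < n)%nat ->
  0 < R -> (forall p, dot p p = R -> 0 < weight A B p /\ C ^ 2 < dot (diag A B p) p ^ 2) ->
  conjugate_polygon n A B C R u -> conjugate_polygon n A B C R v ->
  0 < det (u 0%nat) (u (nxt n 0)) * det (v 0%nat) (v (nxt n 0)) ->
  prodR (fun k => weight A B (u k)) n = prodR (fun k => weight A B (v k)) n.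
Proof.
  intros Hn HR HP Hu Hv Ho.
  set (X := fun i => det (u i) (v (nxt n i))). set (Y := fun i => det (v i) (u (nxt n i))).
  destruct (Req_dec (prodR X n) 0) as [E | HX];
    [| destruct (Req_dec (prodR Y n) 0) as [E | HY]].
  - apply prodR_eq0 in E as [i [Hi E]]. assert (Hi' := nxt_lt n i Hn).
    (* A vanishing [X i] makes [u i] and [v (nxt n i)] equal or antipodal. *)
    apply (weight_product_of_same_line n A B C R u v i (nxt n i)); auto.
    apply (det_eq0_same_line _ _ R); auto; [apply Hv | apply Hu |]; auto.
    unfold X, det in *; lra.
  - apply prodR_eq0 in E as [i [Hi E]]. assert (Hi' := nxt_lt n i Hn).
    symmetry; apply (weight_product_of_same_line n A B C R v u i (nxt n i)); auto; [lra |].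
    apply (det_eq0_same_line _ _ R); auto; [apply Hu | apply Hv |]; auto.
    unfold Y, det in *; lra.
  - apply Rmult_eq_reg_r with (prodR Y n * prodR X n);
      [| apply Rmult_integral_contrapositive; auto].
    (* Shifting one index cyclically leaves the full product unchanged, so the claim can be checked
       factor by factor. *)
    transitivity (prodR (fun i => weight A B (u i) * (Y i * X (prv n i))) n).
    { rewrite !prodR_mult, (prodR_prv X); reflexivity. }
    transitivity (prodR (fun i => weight A B (v i) * (X i * Y (prv n i))) n).
    2: { rewrite !prodR_mult, (prodR_prv Y); ring. }
    apply prodR_ext; intros i Hi.
    unfold X, Y; rewrite nxt_prv by exact Hi.
    destruct (Hu i Hi) as [Hui _]. destruct (Hv i Hi) as [Hvi _].
    pose proof (conjugate_det_product n A B C R u i (v i) Hu Hi (proj1 (HP _ Hui)) Hvi) as Eu.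
    pose proof (conjugate_det_product n A B C R v i (u i) Hv Hi (proj1 (HP _ Hvi)) Hui) as Ev.
    rewrite diag_sym in Ev. rewrite Eu, Ev. reflexivity.
Qed.

(** * From Poncelet polygons to the product of cosines *)

Lemma poncelet_conjugate (n : nat) (O : pt) (r a b th : R) (u : nat -> pt) :
  0 < a -> 0 < b -> (0 < n)%nat -> poncelet_ngon n O r a b th u ->
  conjugate_polygon n (a ^ 2 - b ^ 2 - r ^ 2) (b ^ 2 - a ^ 2 - r ^ 2)
    ((r ^ 2 - a ^ 2 - b ^ 2) * r ^ 2) (r ^ 2) (fun i => frame O th (u i)).
Proof.
  intros Ha Hb Hn H i Hi.
  destruct (H i Hi) as [H1 [H2 [H3 H4]]].
  destruct (H _ (nxt_lt n i Hn)) as [H5 _].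
  apply (on_circle_frame _ _ th) in H1. apply (on_circle_frame _ _ th) in H5.
  split; [exact H1 | split].
  - apply tangent_chord_bilinear; auto.
    + intros E; apply frame_inj in E; auto.
    + apply tangent_discriminant; auto.
  - intros E; apply frame_inj in E; auto.
Qed.

(** The two gaps are [2 (R - a^2) x^2 + 2 (R - b^2) y^2] and [2 b^2 x^2 + 2 a^2 y^2]. The first
    bound fixes the sign of the cosine; both together give the strict inequality of squares behind
    the orientation lemmas. *)
Lemma self_pairing_bounds (R a b : R) (p : pt) :
  0 < a -> 0 < b -> a ^ 2 < R -> b ^ 2 < R -> dot p p = R ->
  let A := a ^ 2 - b ^ 2 - R in let B := b ^ 2 - a ^ 2 - R in
  let C := (R - a ^ 2 - b ^ 2) * R in
  0 < weight A B p /\ dot (diag A B p) p < C /\ dot (diag A B p) p < - C.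
Proof.
  intros Ha Hb HaR HbR Hp A B C.
  assert (0 < a ^ 2 /\ 0 < b ^ 2) as [Ha2 Hb2] by (split; nra).
  destruct p as [x y]; unfold weight, dot, diag in *; simpl fst in *; simpl snd in *.
  assert (Hx : 0 <= x * x) by nra. assert (Hy : 0 <= y * y) by nra.
  assert (Hxy : 0 < x * x \/ 0 < y * y) by (destruct (Rle_lt_dec (x * x) 0); [right | left]; lra).
  assert (HA : A < 0) by (unfold A; lra). assert (HB : B < 0) by (unfold B; lra).
  assert (0 < A * A /\ 0 < B * B) as [HA2 HB2] by (split; nra).
  repeat split.
  - replace (_ + _) with (A * A * (x * x) + B * B * (y * y)) by ring.
    destruct Hxy; nra.
  - assert (E : C - (A * x * x + B * y * y) =
                2 * (R - a ^ 2) * (x * x) + 2 * (R - b ^ 2) * (y * y)).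
    { transitivity ((R - a ^ 2 - b ^ 2) * (x * x + y * y) - (A * x * x + B * y * y));
        [rewrite Hp; reflexivity | unfold A, B; ring]. }
    destruct Hxy; nra.
  - assert (E : - C - (A * x * x + B * y * y) = 2 * b ^ 2 * (x * x) + 2 * a ^ 2 * (y * y)).
    { transitivity (- ((R - a ^ 2 - b ^ 2) * (x * x + y * y)) - (A * x * x + B * y * y));
        [rewrite Hp; reflexivity | unfold A, B; ring]. }
    destruct Hxy; nra.
Qed.

(** The level [C] is common to all vertices, so the polygon enters the product of cosines only
    through its weights. *)
Lemma cos_product_weight (n : nat) (O : pt) (A B C R th : R) (u : nat -> pt) :
  0 < R ->
  (forall p, dot p p = R -> 0 < weight A B p /\ dot (diag A B p) p < C) ->
  conjugate_polygon n A B C R (fun i => frame O th (u i)) ->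
  cos_product n u =
  C ^ n / sqrt (prodR (fun _ => R) n * prodR (fun i => weight A B (frame O th (u i))) n).
Proof.
  intros HR HP H.
  transitivity (prodR (fun i => C / sqrt (R * weight A B (frame O th (u i)))) n).
  - apply prodR_ext; intros i Hi.
    rewrite <- (frame_angle O th).
    destruct (H i Hi) as [H1 [H2 H3]]. destruct (HP _ H1) as [HM HC].
    apply cos_angle_chord; auto.
    + apply (H (prv n i)), prv_lt; lia.
    + apply (H (nxt n i)), nxt_lt; lia.
    + apply (conjugate_prv n A B C R _ i H Hi).
  - rewrite <- prodR_mult. apply (prodR_div_sqrt (fun i => R * weight A B (frame O th (u i)))).
    intros i Hi. apply Rmult_lt_0_compat; [exact HR | apply HP, (H i Hi)].
Qed.

Theorem theorem5p1 :
  forall (n : nat) (O : pt) (r a b th : R) (u v : nat -> pt),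
    (3 <= n)%nat ->
    0 < r -> 0 < a -> 0 < b ->
    (* the ellipse lies inside the circle *)
    (forall p, on_ellipse O a b th p -> pdist p O < r) ->
    poncelet_ngon n O r a b th u ->
    poncelet_ngon n O r a b th v ->
    (* v traverses the circle in the same rotational sense as u,
       i.e. v belongs to the Poncelet family of u *)
    0 < det (vsub (u 0%nat) O) (vsub (u 1%nat) O) * det (vsub (v 0%nat) O) (vsub (v 1%nat) O) ->
    cos_product n u = cos_product n v.
Proof.
  intros n O r a b th u v Hn Hr Ha Hb Hin Hu Hv Ho.
  destruct (inside_semiaxes O r a b th Hr Ha Hb Hin) as [Har Hbr].
  assert (HR : 0 < r ^ 2) by nra.
  assert (Ha2 : a ^ 2 < r ^ 2) by nra. assert (Hb2 : b ^ 2 < r ^ 2) by nra.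
  apply poncelet_conjugate in Hu; try lia; auto.
  apply poncelet_conjugate in Hv; try lia; auto.
  assert (HP := fun p => self_pairing_bounds (r ^ 2) a b p Ha Hb Ha2 Hb2).
  cbv zeta in HP.
  assert (H1n : nxt n 0 = 1%nat) by (unfold nxt; apply Nat.mod_small; lia).
  rewrite (cos_product_weight n O _ _ _ _ th u HR) with (2 := Hu)
    by (intros p Hp; split; apply (HP p Hp)).
  rewrite (cos_product_weight n O _ _ _ _ th v HR) with (2 := Hv)
    by (intros p Hp; split; apply (HP p Hp)).
  do 3 f_equal.
  apply (weight_product n _ _ _ _ (fun i => frame O th (u i)) (fun i => frame O th (v i))
           ltac:(lia) HR) with (2 := Hu) (3 := Hv).
  - intros p Hp; destruct (HP p Hp) as [HM [HC1 HC2]]; split; [exact HM | nra].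
  (* The change of coordinates is a rotation after a translation of [O] to the origin, so it
     preserves the orientation condition. *)
  - rewrite H1n, !frame_det; exact Ho.
Qed.
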